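(* Let $a(z)=\sum_{i=-m}^{n}a_iz^i$ be a Laurent polynomial with complex coefficients, $m,n>0$, $a_{-m}\neq 0$, $a_n\ne 0$, let $E=(e_{i,j})_{i,j\ge 1}$ be a semi-infinite complex matrix with finitely many nonzero entries, and let $A=T(a)+E$, where $T(a)=(a_{j-i})_{i,j\ge 1}$. For $N\ge 1$ let $A_N$ be the $N\times N$ leading principal submatrix of $A$. Then for any eigenvalue $\lambda$ of $A$ and for any $\epsilon>0$ there exists $N_0>0$ such that for any $N\ge N_0$ the number $\lambda$ belongs to the $\epsilon$-pseudospectrum $$\mathrm{sp}_\epsilon(A_N)=\{z\in\mathbb C:\ \|(A_N-zI)^{-1}\|\ge\epsilon^{-1}\}.$$
   Context: $A$ is regarded as a bounded operator on $\ell^2$, the space of complex sequences $(v_i)_{i\ge1}$ with $\sum_i|v_i|^2<\infty$. An eigenvalue of $A$ is a $\lambda\in\mathbb C$ for which there is $\bm v\in\ell^2$, $\bm v\ne0$, with $A\bm v=\lambda\bm v$. $\|\cdot\|$ is the (operator) 2-norm, and by the usual convention $\|(A_N-zI)^{-1}\|=\infty$ if $z$ is an eigenvalue of $A_N$, so that eigenvalues of $A_N$ belong to $\mathrm{sp}_\epsilon(A_N)$. *)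

(* Defs.v *)
From HB Require Import structures.
From mathcomp Require Import all_boot all_order all_algebra.
From mathcomp Require Import complex.
From mathcomp Require Import all_classical all_reals all_analysis.

Set Implicit Arguments.
Unset Strict Implicit.
Unset Printing Implicit Defensive.

Import Order.TTheory GRing.Theory Num.Theory.
Import numFieldNormedType.Exports.

Local Open Scope classical_set_scope.
Local Open Scope ring_scope.
Local Open Scope complex_scope.

(* A Laurent polynomial is given by its coefficients, [a k] being that of z^k.
   Semi-infinite matrices and sequences are indexed from 0 instead of 1; the
   entries of [T(a)] only depend on [j - i], so this shift is harmless. *)
Definition toeplitz (R : realType) (a : int -> R[i]) (i j : nat) : R[i] :=
  a (j%:Z - i%:Z).

Definition finitely_supported (R : realType) (E : nat -> nat -> R[i]) : Prop :=
  finite_set [set ij : nat * nat | E ij.1 ij.2 != 0].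

Definition ell2 (R : realType) : set (nat -> R[i]) :=
  [set v | (\sum_(0 <= i <oo) (complex.Re `|v i| ^+ 2)%:E < +oo)%E].

(* [w = A v] : each series [\sum_j A_ij v_j] converges, with sum [w_i].
   For a banded matrix plus a finitely supported one these sums are finite.
   The alias [R[i]^o] is the one that carries the topology. *)
Definition image_by (R : realType) (A : nat -> nat -> R[i]) (v w : nat -> R[i])
    : Prop :=
  forall i, series (fun j => A i j * v j : R[i]^o) @ \oo --> (w i : R[i]^o).

Definition ell2_eigenvalue (R : realType) (A : nat -> nat -> R[i])
    (lambda : R[i]) : Prop :=
  exists v : nat -> R[i],
    [/\ ell2 v, exists i, v i != 0 & image_by A v (fun i => lambda * v i)].

Definition leading_submx (R : realType) (A : nat -> nat -> R[i]) (N : nat)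
    : 'M[R[i]]_N :=
  \matrix_(i < N, j < N) A i j.

Definition norm2 (R : realType) (N : nat) (x : 'cV[R[i]]_N) : R :=
  Num.sqrt (\sum_(i < N) complex.Re `|x i 0| ^+ 2).

Definition opnorm2 (R : realType) (N : nat) (B : 'M[R[i]]_N) : \bar R :=
  ereal_sup [set (norm2 (B *m x))%:E | x in [set x | norm2 x <= 1]].

(* The norm of [(B - z I)^-1], with value [+oo] at the eigenvalues of [B].
   [eigenvalue] is defined with row eigenvectors, which makes no difference for
   the set of eigenvalues; see [eigenvalue_unitmx]. *)
Definition resolvent_norm (R : realType) (N : nat) (B : 'M[R[i]]_N) (z : R[i])
    : \bar R :=
  if eigenvalue B z then +oo%E else opnorm2 (invmx (B - z%:M)).

Lemma eigenvalue_unitmx (R : realType) (N : nat) (B : 'M[R[i]]_N) (z : R[i]) :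
  eigenvalue B z = (B - z%:M \notin unitmx).
Proof. by rewrite /eigenvalue /eigenspace kermx_eq0 row_free_unit. Qed.

Definition pseudospectrum (R : realType) (N : nat) (eps : R) (B : 'M[R[i]]_N)
    : set R[i] :=
  [set z | ((eps^-1)%:E <= resolvent_norm B z)%E].

(* Main.v *)
Require Import Defs.
From HB Require Import structures.
From mathcomp Require Import all_boot all_order all_algebra.
From mathcomp Require Import complex zify.
From mathcomp Require Import all_classical all_reals all_analysis.

Set Implicit Arguments.
Unset Strict Implicit.
Unset Printing Implicit Defensive.

Import Order.TTheory GRing.Theory Num.Theory.
Import numFieldNormedType.Exports.

Local Open Scope classical_set_scope.
Local Open Scope ring_scope.
Local Open Scope complex_scope.

(** If [v] is an eigenvector and [x] its truncation to the first [N]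
   coordinates, then, once [N] exceeds the support of [E], the residual
   [(A_N - lambda I) x] vanishes outside its last [n] coordinates, and these are
   combinations of [v_N, ..., v_(N + n - 1)] with coefficients among the [a_k].
   Hence the residual tends to 0 as [N] grows, while the norm of [x] stays
   bounded below by any fixed nonzero coordinate of [v]. *)

(** The modulus on [R[i]] is itself an element of [R[i]], with zero imaginary part; [complex.Re]
    moves it to [R], where all estimates take place. *)
Lemma norm_complexE (R : rcfType) (x : R[i]) :
  `|x| = (complex.Re `|x|)%:C.
Proof. by rewrite RRe_real // normr_real. Qed.

Lemma Re_norm_ge0 (R : rcfType) (x : R[i]) : 0 <= complex.Re `|x|.
Proof. by have := normr_ge0 x; rewrite lecE => /andP[]. Qed.

Lemma Re_norm_gt0 (R : rcfType) (x : R[i]) : (0 < complex.Re `|x|) = (x != 0).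
Proof.
rewrite lt_neqAle Re_norm_ge0 andbT eq_sym; congr (~~ _).
by rewrite -(normr_eq0 x) [in RHS]norm_complexE eq_complex /= eqxx andbT.
Qed.

Lemma Re_normM (R : rcfType) (x y : R[i]) :
  complex.Re `|x * y| = complex.Re `|x| * complex.Re `|y|.
Proof. by rewrite normrM norm_complexE [`|y|]norm_complexE /= mulr0 subr0. Qed.

Lemma Re_normC (R : rcfType) (r : R) : complex.Re `|r%:C| = `|r|.
Proof. by rewrite normc_def /= expr0n addr0 sqrtr_sqr. Qed.

Lemma ler_Re_norm_sum (R : rcfType) (I : Type) (s : seq I) (P : pred I)
    (F : I -> R[i]) :
  complex.Re `|\sum_(i <- s | P i) F i|
    <= \sum_(i <- s | P i) complex.Re `|F i|.
Proof.
have := ler_norm_sum s F P; rewrite lecE => /andP[_].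
by rewrite (raddf_sum (@complex.Re R)).
Qed.

Lemma norm2_ge0 (R : realType) (N : nat) (x : 'cV[R[i]]_N) : 0 <= norm2 x.
Proof. exact: sqrtr_ge0. Qed.

Lemma norm2_ge_coord (R : realType) (N : nat) (x : 'cV[R[i]]_N) (i : 'I_N) :
  complex.Re `|x i 0| <= norm2 x.
Proof.
rewrite -(ler_pXn2r (n := 2)) ?nnegrE ?Re_norm_ge0 ?norm2_ge0 //.
rewrite sqr_sqrtr; last by apply: sumr_ge0 => j _; exact: exprn_ge0 (Re_norm_ge0 _).
rewrite (bigD1 i) //= lerDl.
by apply: sumr_ge0 => j _; exact: exprn_ge0 (Re_norm_ge0 _).
Qed.

Lemma norm2Z (R : realType) (N : nat) (c : R) (x : 'cV[R[i]]_N) :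
  norm2 (c%:C *: x) = `|c| * norm2 x.
Proof.
rewrite /norm2 -(sqrtr_sqr c) -sqrtrM ?sqr_ge0 // mulr_sumr.
by congr Num.sqrt; apply: eq_bigr => i _; rewrite mxE Re_normM Re_normC exprMn real_normK ?num_real.
Qed.

Lemma norm2_eq0 (R : realType) (N : nat) (x : 'cV[R[i]]_N) :
  (norm2 x == 0) = (x == 0).
Proof.
apply/idP/eqP => [/eqP x0|->].
  apply/matrixP => i j; rewrite ord1 mxE; apply/eqP.
  by rewrite -[_ == _]negbK -Re_norm_gt0 -leNgt -x0 norm2_ge_coord.
by rewrite -(scale0r (0 : 'cV_N)) -[0 : R[i]]/(0%:C) norm2Z normr0 mul0r.
Qed.

Lemma opnorm2_ge (R : realType) (N : nat) (B : 'M[R[i]]_N) (x : 'cV[R[i]]_N)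
    (c : R) :
  0 < norm2 x -> c * norm2 x <= norm2 (B *m x) -> (c%:E <= opnorm2 B)%E.
(* Rescaling [x] by [t] puts it on the unit sphere, hence among the vectors of the supremum. *)
Proof.
move=> x0 cx; set t := (norm2 x)^-1.
have tE : `|t| = (norm2 x)^-1 by rewrite ger0_norm // invr_ge0 norm2_ge0.
apply: (@le_trans _ _ (norm2 (B *m (t%:C *: x)))%:E).
  by rewrite lee_fin -scalemxAr norm2Z tE mulrC ler_pdivlMr.
apply: ereal_sup_ubound; exists (t%:C *: x) => //=.
by rewrite norm2Z tE mulVf // gt_eqF.
Qed.

(** An approximate eigenvector is a certificate: when [B - z I] is invertible, its inverse sends the
    residual [r] back to [x], so it stretches [r] by a factor of at least [eps^-1]. *)
Lemma pseudospectrum_residual (R : realType) (N : nat) (B : 'M[R[i]]_N)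
    (z : R[i]) (eps : R) (x : 'cV[R[i]]_N) :
  0 < eps -> x != 0 -> norm2 ((B - z%:M) *m x) <= eps * norm2 x ->
  pseudospectrum eps B z.
Proof.
move=> eps0 x0 Bx; rewrite /pseudospectrum /resolvent_norm /=.
case: ifPn => [_|]; first exact: leey.
rewrite eigenvalue_unitmx negbK => Bu.
set r := _ *m x in Bx *.
have xE : invmx (B - z%:M) *m r = x by rewrite mulKmx.
apply: (@opnorm2_ge _ _ _ r).
  rewrite lt_neqAle norm2_ge0 andbT eq_sym norm2_eq0.
  by apply: contraNneq x0 => r0; rewrite -xE r0 mulmx0.
by rewrite xE mulrC ler_pdivrMr // mulrC.
Qed.

(** The finite extended-real sum bounds the partial sums of the squared moduli, so their real series
    converges and its terms tend to 0. *)
Lemma ell2_cvg0 (R : realType) (v : nat -> R[i]) (d : R) :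
  ell2 v -> 0 < d ->
  exists M, forall j, (M <= j)%N -> complex.Re `|v j| <= d.
Proof.
move=> v2 d0; pose f i := complex.Re `|v i| ^+ 2.
have f0 i : 0 <= f i by exact: exprn_ge0 (Re_norm_ge0 _).
have fe0 : forall i, (0 <= i)%N -> true -> (0 <= (f i)%:E)%E.
  by move=> i _ _; rewrite lee_fin.
have cf : cvgn (series f).
  apply: nondecreasing_is_cvgn.
    apply/nondecreasing_seqP => k.
    by rewrite /series /= big_nat_recr //= lerDl.
  exists (fine (\sum_(0 <= i <oo) (f i)%:E)%E) => _ [k _ <-].
  rewrite -lee_fin fineK; last first.
    by rewrite ge0_fin_numE //; exact: nneseries_ge0.
  by rewrite /series /= -sumEFin; exact: nneseries_lim_ge.
have /cvgr0Pnorm_lt/(_ (d ^+ 2) (exprn_gt0 _ d0)) := cvg_series_cvg_0 cf.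
case=> M _ HM; exists M => j /HM /=; rewrite ger0_norm // => /ltW.
by rewrite ler_pXn2r // nnegrE ?Re_norm_ge0 // ltW.
Qed.

Lemma image_by_finite_row (R : realType) (A : nat -> nat -> R[i])
    (v w : nat -> R[i]) (i K : nat) :
  image_by A v w -> (forall j, (K <= j)%N -> A i j = 0) ->
  \sum_(0 <= j < K) A i j * v j = w i.
Proof.
move=> /(_ i) Aw A0.
suff : series (fun j => A i j * v j : R[i]^o) @ \oo
         --> (\sum_(0 <= j < K) A i j * v j : R[i]^o).
  by move=> h; exact: (norm_cvg_unique h Aw).
(* The partial sums are constant from [K] on. *)
apply: cvg_near_cst; exists K => // k /= Kk.
rewrite /series /= (big_cat_nat _ Kk) //= [X in _ + X]big_nat_cond [X in _ + X]big1 ?addr0 //.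
by move=> j /andP[/andP[Kj _] _]; rewrite A0 ?mul0r.
Qed.

Lemma finitely_supported_cols (R : realType) (E : nat -> nat -> R[i]) :
  finitely_supported E ->
  exists J, forall i j, (J <= j)%N -> E i j = 0.
Proof.
move=> /finite_seqP[S SE]; exists (\max_(ij <- S) ij.2).+1%N => i j Jj.
apply/eqP/negPn/negP => Eij.
have ijS : (i, j) \in S by have : [set` S] (i, j) by rewrite -SE.
by have := @leq_bigmax_seq _ _ xpredT snd _ ijS isT; rewrite leqNgt Jj.
Qed.

Lemma upper_coef_bound (R : realType) (n : nat) (a : int -> R[i]) :
  (forall k : int, n%:Z < k -> a k = 0) ->
  exists C : R, 0 <= C /\ forall k : nat, complex.Re `|a k%:Z| <= C.
Proof.
move=> a0; exists (\sum_(k < n.+1) complex.Re `|a k%:Z|).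
have S0 (P : pred 'I_n.+1) : 0 <= \sum_(k < n.+1 | P k) complex.Re `|a k%:Z|.
  by apply: sumr_ge0 => k _; exact: Re_norm_ge0.
split=> // k; case: (ltnP k n.+1) => kn; last by rewrite a0 ?normr0.
by rewrite (bigD1 (Ordinal kn)) //= lerDl.
Qed.

Lemma sumr_last_le (R : realType) (f : nat -> R) (N n : nat) (b : R) :
  (n <= N)%N -> (forall i, (i < N - n)%N -> f i = 0) ->
  (forall i, f i <= b) -> \sum_(i < N) f i <= b *+ n.
Proof.
move=> nN f0 fb; rewrite -(big_mkord xpredT f) (big_cat_nat _ (leq_subr n N)) //=.
rewrite big_nat_cond big1 ?add0r; last by move=> i /andP[/andP[_ /f0]].
apply: (le_trans (ler_sum _ (fun i _ => fb i))).
by rewrite sumr_const_nat subKn.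
Qed.

(** In row [i < N] the entries of [A] vanish from column [N + n] on, as there [j - i > n]. The first
    [N] columns of the eigenvalue equation give the truncated product; the other [n] become the
    residual. *)
Lemma truncation_residual (R : realType) (n : nat) (a : int -> R[i])
    (E : nat -> nat -> R[i]) (lambda : R[i]) (v : nat -> R[i]) (N : nat)
    (i : 'I_N) :
  let A := fun i j : nat => toeplitz a i j + E i j in
  (forall k : int, n%:Z < k -> a k = 0) ->
  (forall i j, (N <= j)%N -> E i j = 0) ->
  image_by A v (fun i => lambda * v i) ->
  ((leading_submx A N - lambda%:M) *m \col_(j < N) v j) i 0
    = - \sum_(N <= j < N + n) a (j%:Z - i%:Z) * v j.
Proof.
move=> A a0 E0 Av.
rewrite mulmxBl mul_scalar_mx !mxE.
have <- := @image_by_finite_row _ _ _ _ i (N + n) Av; last first.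
  move=> j Nj; rewrite /A /toeplitz E0 ?addr0; last by lia.
  by apply: a0; have := ltn_ord i; lia.
rewrite (big_cat_nat _ (leq_addr n N)) //= opprD addrA big_mkord.
rewrite (eq_bigr (fun j : 'I_N => A i j * v j)); last by move=> j _; rewrite !mxE.
rewrite subrr add0r; congr (- _).
apply: eq_big_nat => j /andP[Nj _].
by rewrite /A E0 // addr0.
Qed.

(** At most [n] entries of the residual are nonzero, each a sum of [n] terms of modulus at most
    [C * d]. *)
Lemma truncation_residual_norm2 (R : realType) (n : nat) (a : int -> R[i])
    (E : nat -> nat -> R[i]) (lambda : R[i]) (v : nat -> R[i]) (N : nat)
    (C d : R) :
  let A := fun i j : nat => toeplitz a i j + E i j in
  (forall k : int, n%:Z < k -> a k = 0) ->
  (forall k : nat, complex.Re `|a k%:Z| <= C) ->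
  (forall i j, (N <= j)%N -> E i j = 0) ->
  (forall j, (N <= j)%N -> complex.Re `|v j| <= d) ->
  image_by A v (fun i => lambda * v i) -> (n <= N)%N ->
  norm2 ((leading_submx A N - lambda%:M) *m \col_(j < N) v j)
    <= Num.sqrt ((C * d *+ n) ^+ 2 *+ n).
Proof.
move=> A a0 aC E0 vd Av nN; rewrite /norm2 ler_wsqrtr //.
pose g i := \sum_(N <= j < N + n) a (j%:Z - i%:Z) * v j.
(* [sumr_last_le] asks for a bound at every natural [i], but [C] only controls coefficients with
   [j - i >= 0]; hence the cut-off at [N]. *)
pose f i := if (i < N)%N then complex.Re `|g i| ^+ 2 else 0.
rewrite (eq_bigr (fun i : 'I_N => f i)); last first.
  by move=> i _; rewrite (truncation_residual i a0 E0 Av) normrN /f ltn_ord.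
apply: sumr_last_le => // i; rewrite /f; case: ifPn => iN; rewrite ?sqr_ge0 //.
  (* Here [i < N - n] and [N <= j], so [j - i > n] lies beyond the band. *)
  move=> iNn; rewrite /g big_nat_cond big1 ?normr0 ?expr0n //.
  by move=> j /andP[/andP[Nj _] _]; rewrite a0 ?mul0r //; lia.
have gC : complex.Re `|g i| <= C * d *+ n.
  apply: (le_trans (ler_Re_norm_sum _ _ _)).
  rewrite -[n in _ *+ n](addKn N) -sumr_const_nat.
  apply: ler_sum_nat => j /andP[Nj _]; rewrite Re_normM.
  apply: ler_pM; rewrite ?Re_norm_ge0 ?vd //.
  by have -> : j%:Z - i%:Z = (j - i)%N%:Z by lia.
by rewrite lerXn2r ?nnegrE ?Re_norm_ge0 // (le_trans (Re_norm_ge0 (g i))).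
Qed.

Theorem mainTheorem3 (R : realType) (m n : nat) (a : int -> R[i])
    (E : nat -> nat -> R[i])
    (m_gt0 : (0 < m)%N) (n_gt0 : (0 < n)%N)
    (a_supp : forall k : int, k < - m%:Z \/ n%:Z < k -> a k = 0)
    (a_low : a (- m%:Z) != 0) (a_high : a n%:Z != 0)
    (E_fin : finitely_supported E) :
  let A := fun i j : nat => toeplitz a i j + E i j in
  forall lambda : R[i], ell2_eigenvalue A lambda ->
  forall eps : R, 0 < eps ->
  exists N0 : nat, (0 < N0)%N /\
    forall N : nat, (N0 <= N)%N ->
      pseudospectrum eps (leading_submx A N) lambda.
Proof.
move=> A lambda [v [v2 [i0 vi0] Av]] eps eps0.
have a0 k : n%:Z < k -> a k = 0 by move=> nk; apply: a_supp; right.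
have [C [C0 aC]] := upper_coef_bound a0.
have [J EJ] := finitely_supported_cols E_fin.
set t := complex.Re `|v i0|.
have t0 : 0 < t by rewrite Re_norm_gt0.
(* [C] is only known to be nonnegative, so [C + 1] serves as the denominator. *)
have C1 : 0 < C + 1 by rewrite ltr_wpDl.
have nR : 0 < n%:R :> R by rewrite ltr0n.
(* The bound of truncation_residual_norm2 is C * d * n ^ (3/2) <= C * d * n ^ 2. *)
pose d := eps * t / ((C + 1) * n%:R ^+ 2).
have d0 : 0 < d by rewrite divr_gt0 ?mulr_gt0 ?exprn_gt0.
have [M vM] := ell2_cvg0 v2 d0.
(* [n] and [J] make the residual bound available, [M] makes the tail of [v] small, and [i0.+1] keeps
   the nonzero coordinate [v i0] in the truncation. *)
exists (maxn (maxn n J) (maxn M i0.+1)); split; first by lia.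
move=> N NN; have i0N : (i0 < N)%N by lia.
pose x := \col_(j < N) v j.
have tx : t <= norm2 x.
  by have := norm2_ge_coord x (Ordinal i0N); rewrite mxE.
apply: (@pseudospectrum_residual _ _ _ _ _ x) => //.
  by rewrite -norm2_eq0 gt_eqF // (lt_le_trans t0).
(* The target [eps * t] does not depend on [N]. *)
apply: (@le_trans _ _ (eps * t)); last by rewrite ler_pM2l.
apply: (le_trans (@truncation_residual_norm2 _ n _ _ _ _ _ C d a0 aC _ _ Av _)).
- by move=> i j Nj; apply: EJ; lia.
- by move=> j Nj; apply: vM; lia.
- by lia.
have et : 0 <= eps * t by rewrite mulr_ge0 // ltW.
rewrite -(ger0_norm et) -sqrtr_sqr ler_wsqrtr //.
have etE : eps * t = (C + 1) * d * n%:R ^+ 2.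
  by rewrite /d mulrC -mulrA mulrCA mulrC divfK // gt_eqF // mulr_gt0 ?exprn_gt0.
have Cd : 0 <= C * d by rewrite mulr_ge0 // ltW.
have n1 : 1 <= n%:R :> R by rewrite ler1n.
apply: (@le_trans _ _ ((C * d * n%:R ^+ 2) ^+ 2)); last first.
  rewrite lerXn2r ?nnegrE // ?(mulr_ge0 Cd) ?sqr_ge0 // etE.
  by rewrite ler_wpM2r ?sqr_ge0 // ler_wpM2r ?(ltW d0) // lerDl.
rewrite -[C * d *+ n]mulr_natr -[leLHS]mulr_natr.
have -> : (C * d * n%:R ^+ 2) ^+ 2 = (C * d * n%:R) ^+ 2 * n%:R ^+ 2 :> R.
  by rewrite [n%:R ^+ 2]expr2 mulrA exprMn.
by rewrite ler_wpM2l ?sqr_ge0 // expr2 ler_peMr // ltW.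
Qed.
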